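(* Let $\mathcal A$ be a regular category. The following are equivalent. (1) $\mathcal A$ is prohomological. (2) $\mathcal A$ is propointed and the slice category $\mathcal A/0$ is homological. (3) There exists a regular conservative right-adjoint functor $U\colon\mathcal A\to\mathcal X$ with $\mathcal X$ homological. (4) $\mathcal A$ admits an initial object and there exists a regular conservative functor $U\colon\mathcal A\to\mathcal X$ with $\mathcal X$ homological.
   Context: A finitely complete category is propointed if it admits an initial object $0$ and the unique morphism $0\to1$ is a universal extremal epimorphism (an extremal epimorphism all of whose pullbacks are extremal epimorphisms). Protomodular is meant in the sense of Bourn: a finitely complete category is protomodular if for every morphism $v\colon Y\to X$ the pullback functor from the category of points over $X$ (split epimorphisms with codomain $X$ together with a chosen section) to the category of points over $Y$ is conservative. A prohomological category is a propointed regular protomodular category. A homological category is a pointed regular protomodular category. A functor is right-adjoint if it admits a left adjoint, conservative if it reflects isomorphisms; a regular functor between regular categories is one preserving finite limits and regular epimorphisms. *)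

(* Defs.v *)
From Stdlib Require Import List FinFun ProofIrrelevance IndefiniteDescription.

Set Implicit Arguments.
Unset Strict Implicit.
Unset Printing Implicit Defensive.

Declare Scope cat_scope.
Delimit Scope cat_scope with cat.
Local Open Scope cat_scope.

(** * Categories and functors *)

Record Category := {
  Ob :> Type;
  Hom : Ob -> Ob -> Type;
  idm : forall x, Hom x x;
  comp : forall x y z, Hom y z -> Hom x y -> Hom x z;
  comp_idl : forall x y (f : Hom x y), comp (idm y) f = f;
  comp_idr : forall x y (f : Hom x y), comp f (idm x) = f;
  comp_assoc : forall w x y z (h : Hom y z) (g : Hom x y) (f : Hom w x),
    comp h (comp g f) = comp (comp h g) f
}.
Arguments Hom {c} x y.
Arguments idm {c} x.
Arguments comp {c x y z} g f.
Arguments comp_idl {c x y} f.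
Arguments comp_idr {c x y} f.
Arguments comp_assoc {c w x y z} h g f.

Notation "g ∘ f" := (comp g f) (at level 40, left associativity) : cat_scope.

Record Functor (C D : Category) := {
  fobj :> C -> D;
  fmap : forall x y : C, Hom x y -> Hom (fobj x) (fobj y);
  fmap_id : forall x : C, fmap (idm x) = idm (fobj x);
  fmap_comp : forall (x y z : C) (g : Hom y z) (f : Hom x y),
    fmap (g ∘ f) = fmap g ∘ fmap f
}.
Arguments fmap {C D} f {x y} _ : rename.
Arguments fmap_id {C D} f x : rename.
Arguments fmap_comp {C D} f {x y z} _ _ : rename.

Program Definition functor_comp (C D E : Category)
    (G : Functor D E) (F : Functor C D) : Functor C E :=
  {| fobj := fun x => G (F x);
     fmap := fun x y f => fmap G (fmap F f) |}.
Next Obligation. now rewrite !fmap_id. Qed.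
Next Obligation. now rewrite !fmap_comp. Qed.

(** [F] is left adjoint to [U]. *)
Record Adjunction (C D : Category) (F : Functor D C) (U : Functor C D) := {
  adj_to : forall (d : D) (c : C), Hom (F d) c -> Hom d (U c);
  adj_from : forall (d : D) (c : C), Hom d (U c) -> Hom (F d) c;
  adj_from_to : forall d c (f : Hom (F d) c), adj_from (adj_to f) = f;
  adj_to_from : forall d c (g : Hom d (U c)), adj_to (adj_from g) = g;
  adj_nat : forall (d d' : D) (c c' : C)
      (h : Hom d' d) (f : Hom (F d) c) (k : Hom c c'),
    adj_to (k ∘ f ∘ fmap F h) = fmap U k ∘ adj_to f ∘ h
}.

Definition RightAdjoint (C D : Category) (U : Functor C D) : Prop :=
  exists F : Functor D C, inhabited (Adjunction F U).

(** * Classes of morphisms *)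

Section Morphisms.
Variable C : Category.
Implicit Types x y z w : C.

Definition IsIso x y (f : Hom x y) : Prop :=
  exists g : Hom y x, g ∘ f = idm x /\ f ∘ g = idm y.

Definition Mono x y (f : Hom x y) : Prop :=
  forall z (g h : Hom z x), f ∘ g = f ∘ h -> g = h.

Definition Epi x y (f : Hom x y) : Prop :=
  forall z (g h : Hom y z), g ∘ f = h ∘ f -> g = h.

Definition ExtremalEpi x y (f : Hom x y) : Prop :=
  Epi f /\
  forall z (g : Hom x z) (m : Hom z y), Mono m -> m ∘ g = f -> IsIso m.

Definition IsCoequalizer x y z (f g : Hom x y) (q : Hom y z) : Prop :=
  q ∘ f = q ∘ g /\
  forall w (h : Hom y w), h ∘ f = h ∘ g -> exists! k : Hom z w, k ∘ q = h.

Definition RegularEpi y z (q : Hom y z) : Prop :=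
  exists x (f g : Hom x y), IsCoequalizer f g q.

(** * Limits and colimits *)

Definition IsInitial x : Prop := forall y, exists! f : Hom x y, True.

Definition IsTerminal x : Prop := forall y, exists! f : Hom y x, True.

(** The square [f ∘ p = g ∘ q] is a pullback. *)
Definition IsPullback x y z w
    (f : Hom x z) (g : Hom y z) (p : Hom w x) (q : Hom w y) : Prop :=
  f ∘ p = g ∘ q /\
  forall v (a : Hom v x) (b : Hom v y), f ∘ a = g ∘ b ->
    exists! h : Hom v w, p ∘ h = a /\ q ∘ h = b.

Definition UniversalExtremalEpi x y (f : Hom x y) : Prop :=
  ExtremalEpi f /\
  forall z w (g : Hom z y) (p : Hom w x) (q : Hom w z),
    IsPullback f g p q -> ExtremalEpi q.

End Morphisms.

Record Cone (J C : Category) (D : Functor J C) := {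
  apex : C;
  leg : forall j : J, Hom apex (D j);
  leg_nat : forall (i j : J) (u : Hom i j), fmap D u ∘ leg i = leg j
}.
Arguments leg {J C D} c j : rename.
Arguments leg_nat {J C D} c {i j} u : rename.

Definition IsLimit (J C : Category) (D : Functor J C) (c : Cone D) : Prop :=
  forall c' : Cone D,
    exists! h : Hom (apex c') (apex c), forall j, leg c j ∘ h = leg c' j.

Program Definition map_cone (J C E : Category) (F : Functor C E)
    (D : Functor J C) (c : Cone D) : Cone (functor_comp F D) :=
  {| apex := F (apex c);
     leg := fun j => fmap F (leg c j) |}.
Next Obligation. now rewrite <- fmap_comp, leg_nat. Qed.

Definition FiniteCategory (J : Category) : Prop :=
  Finite J /\ forall i j : J, Finite (Hom i j).

Definition FinitelyComplete (C : Category) : Prop :=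
  forall (J : Category) (D : Functor J C), FiniteCategory J ->
    exists c : Cone D, IsLimit c.

(** * Properties of functors *)

Definition Conservative (C D : Category) (F : Functor C D) : Prop :=
  forall (x y : C) (f : Hom x y), IsIso (fmap F f) -> IsIso f.

Definition PreservesFiniteLimits (C E : Category) (F : Functor C E) : Prop :=
  forall (J : Category) (D : Functor J C) (c : Cone D), FiniteCategory J ->
    IsLimit c -> IsLimit (map_cone F c).

Definition PreservesRegularEpis (C D : Category) (F : Functor C D) : Prop :=
  forall (x y : C) (f : Hom x y), RegularEpi f -> RegularEpi (fmap F f).

(** Only meaningful between regular categories. *)
Definition RegularFunctor (C D : Category) (F : Functor C D) : Prop :=
  PreservesFiniteLimits F /\ PreservesRegularEpis F.

(** * Slice categories *)

Section Slice.
Variables (C : Category) (b : C).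

Record SliceOb := { slice_dom : C; slice_map : Hom slice_dom b }.

Record SliceHom (u v : SliceOb) := {
  slice_mor : Hom (slice_dom u) (slice_dom v);
  slice_comm : slice_map v ∘ slice_mor = slice_map u
}.

Lemma slice_hom_eq (u v : SliceOb) (f g : SliceHom u v) :
  slice_mor f = slice_mor g -> f = g.
Proof.
destruct f as [f Hf], g as [g Hg]; simpl; intros ->.
now rewrite (proof_irrelevance _ Hf Hg).
Qed.

Program Definition Slice : Category :=
  {| Ob := SliceOb;
     Hom := SliceHom;
     idm := fun u => {| slice_mor := idm (slice_dom u) |};
     comp := fun u v w g f => {| slice_mor := slice_mor g ∘ slice_mor f |} |}.
Next Obligation. apply comp_idr. Qed.
Next Obligation. now rewrite comp_assoc, !slice_comm. Qed.
Next Obligation. apply slice_hom_eq, comp_idl. Qed.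
Next Obligation. apply slice_hom_eq, comp_idr. Qed.
Next Obligation. apply slice_hom_eq, comp_assoc. Qed.

End Slice.

(** * The category of points over an object *)

Section Points.
Variables (C : Category) (b : C).

Record PtOb := {
  pt_dom : C;
  pt_map : Hom pt_dom b;
  pt_sec : Hom b pt_dom;
  pt_split : pt_map ∘ pt_sec = idm b
}.

Record PtHom (u v : PtOb) := {
  pt_mor : Hom (pt_dom u) (pt_dom v);
  pt_mor_map : pt_map v ∘ pt_mor = pt_map u;
  pt_mor_sec : pt_mor ∘ pt_sec u = pt_sec v
}.

Lemma pt_hom_eq (u v : PtOb) (f g : PtHom u v) :
  pt_mor f = pt_mor g -> f = g.
Proof.
destruct f as [f Hf Hf'], g as [g Hg Hg']; simpl; intros ->.
now rewrite (proof_irrelevance _ Hf Hg), (proof_irrelevance _ Hf' Hg').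
Qed.

Program Definition Pt : Category :=
  {| Ob := PtOb;
     Hom := PtHom;
     idm := fun u => {| pt_mor := idm (pt_dom u) |};
     comp := fun u v w g f => {| pt_mor := pt_mor g ∘ pt_mor f |} |}.
Next Obligation. apply comp_idr. Qed.
Next Obligation. apply comp_idl. Qed.
Next Obligation. now rewrite comp_assoc, !pt_mor_map. Qed.
Next Obligation. now rewrite <- comp_assoc, !pt_mor_sec. Qed.
Next Obligation. apply pt_hom_eq, comp_idl. Qed.
Next Obligation. apply pt_hom_eq, comp_idr. Qed.
Next Obligation. apply pt_hom_eq, comp_assoc. Qed.

End Points.

(** * Pullback functors between categories of points *)

Record Pullback (C : Category) (x y z : C) (f : Hom x z) (g : Hom y z) := {
  pb_ob : C;
  pb_fst : Hom pb_ob x;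
  pb_snd : Hom pb_ob y;
  pb_is : IsPullback f g pb_fst pb_snd
}.

Definition PullbackChoice (C : Category) :=
  forall (x y z : C) (f : Hom x z) (g : Hom y z), Pullback f g.

Section PullbackLift.
Variables (C : Category) (x y z : C) (f : Hom x z) (g : Hom y z).
Variables (P : Pullback f g).

Lemma pb_comm : f ∘ pb_fst P = g ∘ pb_snd P.
Proof. exact (proj1 (pb_is P)). Qed.

Lemma pb_lift_ex (v : C) (a : Hom v x) (b : Hom v y) (e : f ∘ a = g ∘ b) :
  exists h : Hom v (pb_ob P), pb_fst P ∘ h = a /\ pb_snd P ∘ h = b.
Proof. destruct (proj2 (pb_is P) v a b e) as [h [Hh _]]; now exists h. Qed.

Definition pb_lift (v : C) (a : Hom v x) (b : Hom v y) (e : f ∘ a = g ∘ b) :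
    Hom v (pb_ob P) :=
  proj1_sig (constructive_indefinite_description _ (pb_lift_ex e)).

Lemma pb_lift_fst (v : C) (a : Hom v x) (b : Hom v y) (e : f ∘ a = g ∘ b) :
  pb_fst P ∘ pb_lift e = a.
Proof.
exact (proj1 (proj2_sig
  (constructive_indefinite_description _ (pb_lift_ex e)))).
Qed.

Lemma pb_lift_snd (v : C) (a : Hom v x) (b : Hom v y) (e : f ∘ a = g ∘ b) :
  pb_snd P ∘ pb_lift e = b.
Proof.
exact (proj2 (proj2_sig
  (constructive_indefinite_description _ (pb_lift_ex e)))).
Qed.

Lemma pb_hom_eq (v : C) (h k : Hom v (pb_ob P)) :
  pb_fst P ∘ h = pb_fst P ∘ k -> pb_snd P ∘ h = pb_snd P ∘ k -> h = k.
Proof.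
intros H1 H2.
destruct (proj2 (pb_is P) v (pb_fst P ∘ k) (pb_snd P ∘ k)) as [l [_ Hl]].
- now rewrite !comp_assoc, pb_comm.
- rewrite <- (Hl k) by auto; symmetry; apply Hl; auto.
Qed.

End PullbackLift.

Section PullbackFunctor.
Variables (C : Category) (pb : PullbackChoice C) (y x : C) (v : Hom y x).

Lemma pt_pullback_sec_comm (u : PtOb x) :
  pt_map u ∘ (pt_sec u ∘ v) = v ∘ idm y.
Proof. now rewrite comp_assoc, pt_split, comp_idl, comp_idr. Qed.

Definition pt_pullback_ob (u : PtOb x) : PtOb y :=
  {| pt_dom := pb_ob (pb (pt_map u) v);
     pt_map := pb_snd (pb (pt_map u) v);
     pt_sec := pb_lift (pb (pt_map u) v) (pt_pullback_sec_comm u);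
     pt_split := pb_lift_snd _ (pt_pullback_sec_comm u) |}.

Lemma pt_pullback_mor_comm (u w : PtOb x) (f : PtHom u w) :
  pt_map w ∘ (pt_mor f ∘ pb_fst (pb (pt_map u) v))
  = v ∘ pb_snd (pb (pt_map u) v).
Proof. now rewrite comp_assoc, pt_mor_map, pb_comm. Qed.

Program Definition pt_pullback_mor (u w : PtOb x) (f : PtHom u w) :
    PtHom (pt_pullback_ob u) (pt_pullback_ob w) :=
  {| pt_mor := pb_lift (pb (pt_map w) v) (pt_pullback_mor_comm f) |}.
Next Obligation. apply pb_lift_snd. Qed.
Next Obligation.
apply pb_hom_eq; rewrite comp_assoc.
- rewrite !pb_lift_fst, <- comp_assoc, pb_lift_fst, comp_assoc.
  now rewrite pt_mor_sec.
- now rewrite !pb_lift_snd.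
Qed.

Program Definition pt_pullback : Functor (Pt x) (Pt y) :=
  {| fobj := pt_pullback_ob : Pt x -> Pt y;
     fmap := pt_pullback_mor |}.
Next Obligation.
apply pt_hom_eq, pb_hom_eq; simpl.
- now rewrite pb_lift_fst, comp_idl, comp_idr.
- now rewrite pb_lift_snd, comp_idr.
Qed.
Next Obligation.
apply pt_hom_eq, pb_hom_eq; simpl; rewrite comp_assoc.
- now rewrite !pb_lift_fst, <- !comp_assoc, pb_lift_fst.
- now rewrite !pb_lift_snd.
Qed.

End PullbackFunctor.

(** * Classes of categories *)

Definition Regular (C : Category) : Prop :=
  FinitelyComplete C /\
  (forall (x y r : C) (f : Hom x y) (p q : Hom r x), IsPullback f f p q ->
     exists (z : C) (e : Hom x z), IsCoequalizer p q e) /\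
  (forall (x y z w : C) (f : Hom x z) (g : Hom y z)
     (p : Hom w x) (q : Hom w y),
     IsPullback f g p q -> RegularEpi f -> RegularEpi q).

(** Pullback functors are determined up to isomorphism by [v], so whether they
    are conservative does not depend on the choice of pullbacks. *)
Definition Protomodular (C : Category) : Prop :=
  FinitelyComplete C /\
  exists pb : PullbackChoice C,
    forall (x y : C) (v : Hom y x), Conservative (pt_pullback pb v).

Definition Pointed (C : Category) : Prop :=
  exists z : C, IsInitial z /\ IsTerminal z.

Definition HasInitial (C : Category) : Prop := exists z : C, IsInitial z.

Definition Propointed (C : Category) : Prop :=
  FinitelyComplete C /\
  exists (z t : C) (f : Hom z t),
    IsInitial z /\ IsTerminal t /\ UniversalExtremalEpi f.

Definition Homological (C : Category) : Prop :=
  Pointed C /\ Regular C /\ Protomodular C.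

Definition Prohomological (C : Category) : Prop :=
  Propointed C /\ Regular C /\ Protomodular C.

(* Main.v *)
(** The implications are proved in a cycle. Slices inherit regularity and
    protomodularity, and the identity of the initial object is a zero object of
    A/0, so (1) gives (2). Given (2), take for U the functor X |-> X × 0 into
    A/0: it is right adjoint to the domain functor, and the projections
    X × 0 -> X are extremal epimorphisms, being pullbacks of 0 -> 1, whence U is
    conservative. A left adjoint sends 0 to an initial object, so (3) gives (4).
    Finally a conservative functor preserving pullbacks reflects
    protomodularity, and reflects extremality of every morphism that it sends to
    a split epimorphism; it sends 0 -> 1 to a morphism into a zero object, which
    is split, and so are all pullbacks of that morphism. *)

Require Import Defs.
From Stdlib Require Import List IndefiniteDescription.

Set Implicit Arguments.
Unset Strict Implicit.
Unset Printing Implicit Defensive.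
Local Open Scope cat_scope.

(** * Isomorphisms, pullback squares and extremal epimorphisms *)

Section Morphisms.
Variable C : Category.

Lemma initial_hom_eq (x y : C) (f g : Hom x y) : IsInitial x -> f = g.
Proof.
intros H; destruct (H y) as [h [_ Hh]].
now rewrite <- (Hh f I), <- (Hh g I).
Qed.

Lemma terminal_hom_eq (x y : C) (f g : Hom y x) : IsTerminal x -> f = g.
Proof.
intros H; destruct (H y) as [h [_ Hh]].
now rewrite <- (Hh f I), <- (Hh g I).
Qed.

Lemma iso_comp (x y z : C) (g : Hom y z) (f : Hom x y) :
  IsIso g -> IsIso f -> IsIso (g ∘ f).
Proof.
intros [g' [Hg Hg']] [f' [Hf Hf']]; exists (f' ∘ g'); split.
- now rewrite <- comp_assoc, (comp_assoc g'), Hg, comp_idl.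
- now rewrite <- comp_assoc, (comp_assoc f), Hf', comp_idl.
Qed.

Lemma iso_cancel_l (x y z : C) (g : Hom y z) (f : Hom x y) :
  IsIso g -> IsIso (g ∘ f) -> IsIso f.
Proof.
intros [g' [Hg Hg']] H.
replace f with (g' ∘ (g ∘ f)) by now rewrite comp_assoc, Hg, comp_idl.
apply iso_comp; [now exists g | exact H].
Qed.

Lemma split_epi_mono_iso (x y : C) (m : Hom x y) (s : Hom y x) :
  Mono m -> m ∘ s = idm y -> IsIso m.
Proof.
intros Hm Hs; exists s; split; [apply Hm | exact Hs].
now rewrite comp_assoc, Hs, comp_idl, comp_idr.
Qed.

Section PullbackSquare.
Variables (x y z w : C) (f : Hom x z) (g : Hom y z).
Variables (p : Hom w x) (q : Hom w y).
Hypothesis H : IsPullback f g p q.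

Lemma pullback_hom_eq (v : C) (h k : Hom v w) :
  p ∘ h = p ∘ k -> q ∘ h = q ∘ k -> h = k.
Proof. exact (@pb_hom_eq _ _ _ _ _ _ {| pb_is := H |} v h k). Qed.

Lemma pullback_comparison_iso (w' : C) (p' : Hom w' x) (q' : Hom w' y) :
  IsPullback f g p' q' ->
  exists i : Hom w w', IsIso i /\ p' ∘ i = p /\ q' ∘ i = q.
Proof.
intros H'.
destruct (proj2 H' _ _ _ (proj1 H)) as [i [[Hp Hq] _]].
destruct (proj2 H _ _ _ (proj1 H')) as [j [[Hp' Hq'] _]].
exists i; split; [exists j; split | now split].
- apply pullback_hom_eq; rewrite comp_assoc, ?Hp', ?Hq', comp_idr; assumption.
- apply (pb_hom_eq (P := {| pb_is := H' |})); simpl;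
    rewrite comp_assoc, ?Hp, ?Hq, comp_idr; assumption.
Qed.

Lemma pullback_split_epi (s : Hom z x) :
  f ∘ s = idm z -> exists t : Hom y w, q ∘ t = idm y.
Proof.
intros Hs.
assert (E : f ∘ (s ∘ g) = g ∘ idm y)
  by now rewrite comp_assoc, Hs, comp_idl, comp_idr.
destruct (proj2 H _ _ _ E) as [t [[_ Ht] _]]; now exists t.
Qed.

End PullbackSquare.

(** Expressing monomorphisms through a pullback square lets functors that preserve pullbacks act on
    them. *)
Lemma mono_pullback (x y : C) (m : Hom x y) :
  Mono m <-> IsPullback m m (idm x) (idm x).
Proof.
split.
- intros Hm; split; [reflexivity |].
  intros v a b E; exists a; split.
  + split; rewrite comp_idl; [reflexivity | now apply Hm].
  + now intros h [Hh _]; rewrite comp_idl in Hh.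
- intros [_ H] v a b E.
  destruct (H v a b E) as [h [[Ha Hb] _]].
  now rewrite <- Ha, <- Hb.
Qed.

(* The graphs of [g] and [h] meet in the equalizer of [g] and [h]. *)
Lemma graph_pullback_equalizer (pb : PullbackChoice C) (t : C)
    (Ht : IsTerminal t) (z w : C) (g h : Hom z w) :
  exists (e : C) (i : Hom e z),
    Mono i /\ g ∘ i = h ∘ i /\
    forall v (a : Hom v z), g ∘ a = h ∘ a -> exists b, i ∘ b = a.
Proof.
destruct (Ht z) as [tz _], (Ht w) as [tw _].
pose (P := pb _ _ _ tz tw).
assert (graph : forall k : Hom z w, exists l : Hom z (pb_ob P),
  pb_fst P ∘ l = idm z /\ pb_snd P ∘ l = k).
{ intros k; apply pb_lift_ex, (terminal_hom_eq _ _ Ht). }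
destruct (graph g) as [gg [Hg1 Hg2]], (graph h) as [gh [Hh1 Hh2]].
pose (E := pb _ _ _ gg gh).
(* The first component of either graph is the identity, so first components force the two
   projections of [E] to agree. *)
assert (Eeq : pb_fst E = pb_snd E).
{ rewrite <- (comp_idl (pb_fst E)), <- Hg1, <- comp_assoc, pb_comm.
  now rewrite comp_assoc, Hh1, comp_idl. }
exists (pb_ob E), (pb_fst E); split; [| split].
- intros v a b Hab; apply (pb_hom_eq (P := E)); [exact Hab |].
  now rewrite <- Eeq.
- rewrite <- Hg2, <- Hh2, <- !comp_assoc; fold E.
  now rewrite (pb_comm E), Eeq.
- intros v a Ha.
  assert (Hl : gg ∘ a = gh ∘ a).
  { apply (pb_hom_eq (P := P)); rewrite !comp_assoc.
    - now rewrite Hg1, Hh1.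
    - now rewrite Hg2, Hh2. }
  exists (pb_lift E Hl); apply pb_lift_fst.
Qed.

(** If [g ∘ f = h ∘ f], then [f] factors through the equalizer of [g] and [h]; this is a mono, hence
    invertible by the factorization condition, and so [g = h]. *)
Lemma extremal_epi_intro (pb : PullbackChoice C) (t : C) (Ht : IsTerminal t)
    (x y : C) (f : Hom x y) :
  (forall z (g : Hom x z) (m : Hom z y), Mono m -> m ∘ g = f -> IsIso m) ->
  ExtremalEpi f.
Proof.
intros Hf; split; [| exact Hf].
intros w g h E.
destruct (graph_pullback_equalizer pb Ht g h) as [e [i [Hi [Hgh Hu]]]].
destruct (Hu _ f E) as [k Hk].
destruct (Hf _ _ _ Hi Hk) as [j [_ Hj]].
now rewrite <- (comp_idr g), <- (comp_idr h), <- Hj, !comp_assoc, Hgh.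
Qed.

End Morphisms.

Lemma functor_iso (C D : Category) (F : Functor C D) (x y : C) (f : Hom x y) :
  IsIso f -> IsIso (fmap F f).
Proof.
intros [g [Hg Hg']]; exists (fmap F g).
now rewrite <- !fmap_comp, Hg, Hg', !fmap_id.
Qed.

(** * Terminal objects and pullbacks as finite limits *)

Program Definition EmptyCat : Category :=
  {| Ob := Empty_set; Hom := fun _ _ => unit;
     idm := fun _ => tt; comp := fun _ _ _ _ _ => tt |}.
Solve All Obligations with now intros [].

Lemma empty_finite : FiniteCategory EmptyCat.
Proof. split; [now exists nil; intros [] | intros []]. Qed.

Program Definition empty_functor (C : Category) : Functor EmptyCat C :=
  {| fobj := fun e : EmptyCat => match e with end;
     fmap := fun x _ _ => match x with end |}.
Solve All Obligations with now intros [].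

Program Definition empty_cone (C : Category) (D : Functor EmptyCat C) (x : C) :
    Cone D :=
  {| apex := x; leg := fun j => match j with end |}.
Next Obligation. destruct i. Qed.

Lemma limit_empty_terminal (C : Category) (D : Functor EmptyCat C)
    (c : Cone D) : IsLimit c <-> IsTerminal (apex c).
Proof.
split.
- intros H y; destruct (H (empty_cone D y)) as [h [_ Hh]].
  exists h; split; [exact I |].
  intros h' _; apply Hh; intros [].
- intros H c'; destruct (H (apex c')) as [h [_ Hh]].
  exists h; split; [intros [] | auto].
Qed.

(** [Some true] and [Some false] are the two sources and [None] is the common target. Every hom type
    is [unit] or empty, so the category laws hold by [cospan_hom_eq]. *)
Definition cospan_hom (i j : option bool) : Type :=
  match i, j with
  | _, None | Some true, Some true | Some false, Some false => unit
  | _, _ => Empty_set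
  end.

Lemma cospan_hom_eq (i j : option bool) (f g : cospan_hom i j) : f = g.
Proof. now destruct i as [[]|], j as [[]|], f, g. Qed.

Definition cospan_id (i : option bool) : cospan_hom i i :=
  match i with Some true | Some false | None => tt end.

Definition cospan_comp (i j k : option bool) :
  cospan_hom j k -> cospan_hom i j -> cospan_hom i k.
Proof. now destruct i as [[]|], j as [[]|], k as [[]|]. Defined.

Program Definition Cospan : Category :=
  {| Ob := option bool; Hom := cospan_hom;
     idm := cospan_id; comp := cospan_comp |}.
Solve All Obligations with intros; apply cospan_hom_eq.

Lemma cospan_finite : FiniteCategory Cospan.
Proof.
split.
- exists (Some true :: Some false :: None :: nil); intros [[]|]; simpl; auto.
- intros [[]|] [[]|]; first
    [ exists (tt :: nil); intros []; simpl; auto | exists nil; intros [] ].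
Qed.

Definition cospan_left : @Hom Cospan (Some true) None := tt.
Definition cospan_right : @Hom Cospan (Some false) None := tt.

Section CospanDiagram.
Variables (C : Category) (D : Functor Cospan C).

Definition cospan_leg (w : C) (p : Hom w (D (Some true)))
    (q : Hom w (D (Some false))) (j : Cospan) : Hom w (D j) :=
  match j with
  | Some true => p
  | Some false => q
  | None => fmap D cospan_left ∘ p
  end.

Program Definition cospan_cone (w : C) (p : Hom w (D (Some true)))
    (q : Hom w (D (Some false)))
    (e : fmap D cospan_left ∘ p = fmap D cospan_right ∘ q) : Cone D :=
  {| apex := w; leg := cospan_leg p q |}.
Next Obligation.
(* Endomorphisms of the shape are identities, which leaves only the two arrows into [None] to
   check. *)
assert (Hid : forall i (v : @Hom Cospan i i),
  fmap D v ∘ cospan_leg p q i = cospan_leg p q i).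
{ intros k v; rewrite (cospan_hom_eq v (cospan_id k)).
  change (cospan_id k) with (@idm Cospan k).
  now rewrite fmap_id, comp_idl. }
destruct i as [[]|], j as [[]|]; try apply Hid; try destruct u; simpl;
  [reflexivity | now symmetry].
Qed.

Lemma limit_cospan_pullback (c : Cone D) :
  IsLimit c <->
  IsPullback (fmap D cospan_left) (fmap D cospan_right)
    (leg c (Some true)) (leg c (Some false)).
Proof.
(* The leg at [None] is determined by the leg at [Some true], so a cone amounts to a commutative
   square. *)
assert (Hc : forall c' : Cone D, leg c' None
  = fmap D cospan_left ∘ leg c' (Some true)).
{ intros c'; symmetry; apply leg_nat. }
split.
- intros H; split; [now rewrite !leg_nat |].
  intros v a b E; destruct (H (cospan_cone E)) as [h [Hh Hu]].
  exists h; split; [exact (conj (Hh (Some true)) (Hh (Some false))) |].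
  intros k [Hk1 Hk2]; apply Hu; intros [[]|]; simpl; auto.
  now rewrite Hc, <- comp_assoc, Hk1.
- intros [_ H] c'.
  destruct (H _ (leg c' (Some true)) (leg c' (Some false)))
    as [h [[Hh1 Hh2] Hu]]; [now rewrite !leg_nat |].
  exists h; split.
  + intros [[]|]; auto.
    now rewrite !Hc, <- comp_assoc, Hh1.
  + intros k Hk; apply Hu; auto.
Qed.

End CospanDiagram.

Section CospanFunctor.
Variables (C : Category) (x y z : C) (f : Hom x z) (g : Hom y z).

Definition cospan_obj (j : Cospan) : C :=
  match j with Some true => x | Some false => y | None => z end.

Definition cospan_map (i j : Cospan) :
    Hom i j -> Hom (cospan_obj i) (cospan_obj j) :=
  match i, j with
  | Some true, Some true => fun _ => idm x
  | Some false, Some false => fun _ => idm y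
  | None, None => fun _ => idm z
  | Some true, None => fun _ => f
  | Some false, None => fun _ => g
  | Some true, Some false | Some false, Some true
  | None, Some true | None, Some false => fun e => match e with end
  end.

Program Definition cospan_functor : Functor Cospan C :=
  {| fobj := cospan_obj; fmap := cospan_map |}.
Next Obligation. now destruct x0 as [[]|]. Qed.
Next Obligation.
destruct x0 as [[]|], y0 as [[]|], z0 as [[]|]; try destruct g0;
  try destruct f0; simpl; now rewrite ?comp_idl, ?comp_idr.
Qed.

End CospanFunctor.

Lemma complete_terminal (C : Category) :
  FinitelyComplete C -> exists t : C, IsTerminal t.
Proof.
intros H; destruct (H _ (empty_functor C) empty_finite) as [c Hc].
exists (apex c); now apply limit_empty_terminal.
Qed.

Lemma complete_pullback_choice (C : Category) :
  FinitelyComplete C -> inhabited (PullbackChoice C).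
Proof.
intros H; constructor; intros x y z f g.
destruct (constructive_indefinite_description _
  (H _ (cospan_functor f g) cospan_finite)) as [c Hc].
exists (apex c) (leg c (Some true)) (leg c (Some false)).
exact (proj1 (limit_cospan_pullback c) Hc).
Qed.

Section LimitPreservation.
Variables (C D : Category) (U : Functor C D).
Hypothesis HU : PreservesFiniteLimits U.

Lemma preserves_terminal (t : C) : IsTerminal t -> IsTerminal (U t).
Proof.
intros Ht.
apply (limit_empty_terminal (map_cone U (empty_cone (empty_functor C) t))).
apply HU; [exact empty_finite |].
now apply limit_empty_terminal.
Qed.

Lemma preserves_pullback (x y z w : C) (f : Hom x z) (g : Hom y z)
    (p : Hom w x) (q : Hom w y) :
  IsPullback f g p q ->
  IsPullback (fmap U f) (fmap U g) (fmap U p) (fmap U q).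
Proof.
intros H.
(* The composite of [U] with the cospan diagram computes to the cospan of [fmap U f] and [fmap U g],
   so the image cone is literally the image square. *)
pose (c := @cospan_cone C (cospan_functor f g) w p q (proj1 H)).
apply (limit_cospan_pullback (map_cone U c)).
apply HU; [exact cospan_finite |].
now apply limit_cospan_pullback.
Qed.

Lemma preserves_mono (x y : C) (m : Hom x y) : Mono m -> Mono (fmap U m).
Proof.
rewrite !mono_pullback; intros H.
rewrite <- fmap_id; now apply preserves_pullback.
Qed.

End LimitPreservation.

(** * Adjunctions *)

Section Adjoints.
Variables (C D : Category) (F : Functor D C) (U : Functor C D).
Variable adj : Adjunction F U.

Lemma adj_to_post (d : D) (c c' : C) (f : Hom (F d) c) (k : Hom c c') :
  adj_to adj (k ∘ f) = fmap U k ∘ adj_to adj f.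
Proof.
rewrite <- (comp_idr (k ∘ f)), <- fmap_id, adj_nat; apply comp_idr.
Qed.

Lemma adj_to_pre (d d' : D) (c : C) (f : Hom (F d) c) (h : Hom d' d) :
  adj_to adj (f ∘ fmap F h) = adj_to adj f ∘ h.
Proof.
rewrite <- (comp_idl f), adj_nat, fmap_id; now rewrite !comp_idl.
Qed.

Lemma adj_to_inj (d : D) (c : C) (f g : Hom (F d) c) :
  adj_to adj f = adj_to adj g -> f = g.
Proof.
intros E; now rewrite <- (adj_from_to adj f), E, adj_from_to.
Qed.

Program Definition transpose_cone (J : Category) (G : Functor J C)
    (c : Cone (functor_comp U G)) : Cone G :=
  {| apex := F (apex c); leg := fun j => adj_from adj (leg c j) |}.
Next Obligation.
apply adj_to_inj; rewrite adj_to_post, !adj_to_from.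
exact (leg_nat c u).
Qed.

Lemma right_adjoint_preserves_limit (J : Category) (G : Functor J C)
    (c : Cone G) : IsLimit c -> IsLimit (map_cone U c).
Proof.
intros H c'; destruct (H (transpose_cone c')) as [h [Hh Hu]]; simpl in *.
exists (adj_to adj h); split.
- intros j; rewrite <- adj_to_post, Hh; apply adj_to_from.
- intros k Hk; rewrite <- (adj_to_from adj k); f_equal.
  apply Hu; intros j; apply adj_to_inj.
  now rewrite adj_to_post, !adj_to_from.
Qed.

Lemma left_adjoint_preserves_initial (d : D) : IsInitial d -> IsInitial (F d).
Proof.
intros H c; destruct (H (U c)) as [f [_ Hf]].
exists (adj_from adj f); split; [exact I |].
intros g _; now rewrite (Hf (adj_to adj g) I), adj_from_to.
Qed.

(** Maps out of [F y] transpose to maps out of [y], where the coequalizer property is available. It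
    is applied below to the domain functor of a slice. *)
Lemma left_adjoint_preserves_regular_epi (y z : D) (q : Hom y z) :
  RegularEpi q -> RegularEpi (fmap F q).
Proof.
intros [x [f [g [Hq H]]]]; exists (F x), (fmap F f), (fmap F g); split.
- now rewrite <- !fmap_comp, Hq.
- intros w h E.
  destruct (H (U w) (adj_to adj h)) as [k [Hk Hu]].
  { now rewrite <- !adj_to_pre, E. }
  exists (adj_from adj k); split.
  + apply adj_to_inj; now rewrite adj_to_pre, adj_to_from.
  + intros k' Hk'; rewrite (Hu (adj_to adj k')); [apply adj_from_to |].
    now rewrite <- adj_to_pre, Hk'.
Qed.

End Adjoints.

(** * Protomodularity without chosen pullbacks *)

(** Here [k] is a morphism of points from [(f, s)] to [(f', s')], and [m] is its pullback along [v].
    Quantifying over all pullback squares makes the condition a matter of equations and squares in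
    the base, easily transported along functors. *)
Definition PullbacksReflectPointIsos (C : Category) : Prop :=
  forall (a a' x y b b' : C)
    (f : Hom a x) (s : Hom x a) (f' : Hom a' x) (s' : Hom x a')
    (k : Hom a a') (v : Hom y x)
    (p : Hom b a) (q : Hom b y) (p' : Hom b' a') (q' : Hom b' y)
    (m : Hom b b'),
  f ∘ s = idm x -> f' ∘ s' = idm x -> f' ∘ k = f -> k ∘ s = s' ->
  IsPullback f v p q -> IsPullback f' v p' q' ->
  p' ∘ m = k ∘ p -> q' ∘ m = q ->
  IsIso m -> IsIso k.

(** An inverse in the base automatically respects projections and sections. *)
Lemma pt_iso (C : Category) (b : C) (u w : PtOb b) (f : PtHom u w) :
  @IsIso (Pt b) u w f <-> IsIso (pt_mor f).
Proof.
split.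
- intros [g [Hg Hg']]; exists (pt_mor g).
  exact (conj (f_equal (@pt_mor _ _ _ _) Hg) (f_equal (@pt_mor _ _ _ _) Hg')).
- intros [g [Hg Hg']].
  assert (H1 : pt_map u ∘ g = pt_map w)
    by now rewrite <- (pt_mor_map f), <- comp_assoc, Hg', comp_idr.
  assert (H2 : g ∘ pt_sec w = pt_sec u)
    by now rewrite <- (pt_mor_sec f), comp_assoc, Hg, comp_idl.
  exists {| pt_mor := g; pt_mor_map := H1; pt_mor_sec := H2 |}.
  now split; apply pt_hom_eq.
Qed.

Lemma protomodular_iff (C : Category) :
  Protomodular C <-> FinitelyComplete C /\ PullbacksReflectPointIsos C.
Proof.
split; intros [Hlim H]; split; try exact Hlim.
- destruct H as [pb H].
  intros a a' x y b b' f s f' s' k v p q p' q' m Hs Hs' Hk Hks Hp Hp' Hm Hmq Hi.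
  pose (u := {| pt_split := Hs |}); pose (w := {| pt_split := Hs' |}).
  pose (K := Build_PtHom (u := u) (v := w) Hk Hks).
  apply (pt_iso K), (H x y v u w K), pt_iso; simpl.
  (* The isomorphisms [i] and [i'] lead from the chosen pullbacks to the given ones and conjugate
     the map induced by [k] into [m]. *)
  destruct (pullback_comparison_iso (pb_is (pb _ _ _ f v)) Hp)
    as [i [Hi1 [Hi2 Hi3]]].
  destruct (pullback_comparison_iso (pb_is (pb _ _ _ f' v)) Hp')
    as [i' [Hi1' [Hi2' Hi3']]].
  apply (iso_cancel_l Hi1').
  match goal with |- IsIso ?h => replace h with (m ∘ i) end.
  + now apply iso_comp.
  + apply (pullback_hom_eq Hp'); rewrite !comp_assoc.
    * rewrite Hm, Hi2', <- comp_assoc, Hi2; symmetry; apply pb_lift_fst.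
    * rewrite Hmq, Hi3', Hi3; symmetry; apply pb_lift_snd.
- destruct (complete_pullback_choice Hlim) as [pb]; exists pb.
  intros x y v u w f Hf; apply pt_iso; apply pt_iso in Hf.
  refine (H _ _ _ _ _ _ _ _ _ _ _ _ _ _ _ _ _ (pt_split u) (pt_split w)
    (pt_mor_map f) (pt_mor_sec f) (pb_is _) (pb_is _) _ _ Hf);
    [apply pb_lift_fst | apply pb_lift_snd].
Qed.

(** [U] carries the whole configuration of equations, pullback squares and the isomorphism [m] to
    [D]; there [fmap U k] is invertible, and conservativity brings this back. *)
Lemma conservative_reflects_point_isos (C D : Category) (U : Functor C D) :
  PreservesFiniteLimits U -> Conservative U ->
  PullbacksReflectPointIsos D -> PullbacksReflectPointIsos C.
Proof.
intros HU Hc HD a a' x y b b' f s f' s' k v p q p' q' m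
  Hs Hs' Hk Hks Hp Hp' Hm Hmq Hi.
apply Hc.
apply (HD _ _ _ _ _ _ (fmap U f) (fmap U s) (fmap U f') (fmap U s') (fmap U k)
  (fmap U v) (fmap U p) (fmap U q) (fmap U p') (fmap U q') (fmap U m));
  try (rewrite <- ?fmap_comp, <- ?fmap_id; congruence);
  try now apply preserves_pullback.
now apply functor_iso.
Qed.

(** * Slice categories *)

(* Adjoining a terminal object to the shape: limits in a slice over [b] are
   limits in the base of the diagram extended by [b]. *)
Section SliceLimits.
Variable J : Category.

(** [None] is the added terminal object. The codomain is matched first, so that hom types into
    [None] reduce to [unit] even for a variable domain. *)
Definition cap_hom (i j : option J) : Type :=
  match j, i with
  | None, _ => unit
  | Some j, Some i => Hom i j
  | Some _, None => Empty_set
  end.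

Definition cap_id (i : option J) : cap_hom i i :=
  match i with Some i => idm i | None => tt end.

Definition cap_comp (i j k : option J) :
  cap_hom j k -> cap_hom i j -> cap_hom i k.
Proof.
destruct k as [k|]; [| exact (fun _ _ => tt)].
destruct j as [j|]; [| intros []].
destruct i as [i|]; [exact (fun g f => g ∘ f) | intros _ []].
Defined.

Program Definition CapCat : Category :=
  {| Ob := option J; Hom := cap_hom; idm := cap_id; comp := cap_comp |}.
Next Obligation.
destruct y, x; simpl in *; try destruct f; auto using comp_idl.
Qed.
Next Obligation.
destruct y, x; simpl in *; try destruct f; auto using comp_idr.
Qed.
Next Obligation.
destruct z; [| reflexivity].
destruct y; [| destruct h].
destruct x; [| destruct g].
destruct w; [| destruct f].
apply comp_assoc.
Qed.

Lemma cap_finite : FiniteCategory J -> FiniteCategory CapCat.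
Proof.
intros [[l Hl] H]; split.
- exists (None :: map (@Some J) l); intros [j|]; simpl; auto.
  right; apply in_map, Hl.
- intros i [j|]; [destruct i as [i|]; [apply H |] |].
  + exists nil; intros [].
  + exists (tt :: nil); intros []; simpl; auto.
Qed.

Variables (C : Category) (b : C) (D : Functor J (Slice b)).

Definition cap_obj (j : CapCat) : C :=
  match j with Some j => slice_dom (D j) | None => b end.

Definition cap_to (j : CapCat) : Hom (cap_obj j) b :=
  match j with Some j => slice_map (D j) | None => idm b end.

Definition cap_map (i j : CapCat) : Hom i j -> Hom (cap_obj i) (cap_obj j) :=
  match j, i with
  | None, i => fun _ => cap_to i
  | Some j, Some i => fun u => slice_mor (fmap D u)
  | Some _, None => fun e => match e with end
  end.

Program Definition cap_functor : Functor CapCat C :=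
  {| fobj := cap_obj; fmap := cap_map |}.
Next Obligation. destruct x; simpl; now rewrite ?fmap_id. Qed.
Next Obligation.
destruct z; [destruct y; [destruct x |] |].
- simpl; now rewrite fmap_comp.
- destruct f.
- destruct g.
- destruct y; simpl; [destruct x |].
  + symmetry; apply slice_comm.
  + destruct f.
  + now rewrite comp_idl.
Qed.

Program Definition uncap_cone (c : Cone cap_functor) : Cone D :=
  {| apex := {| slice_map := leg c None |} : Slice b;
     leg := fun j => {| slice_mor := leg c (Some j) |} |}.
Next Obligation. exact (leg_nat c (tt : @Hom CapCat (Some j) None)). Qed.
Next Obligation.
apply slice_hom_eq; simpl.
exact (leg_nat c (u : @Hom CapCat (Some i) (Some j))).
Qed.

Definition cap_leg (c : Cone D) (j : CapCat) :
    Hom (slice_dom (apex c)) (cap_functor j) :=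
  match j with
  | Some j => slice_mor (leg c j)
  | None => slice_map (apex c)
  end.

Program Definition cap_cone (c : Cone D) : Cone cap_functor :=
  {| apex := slice_dom (apex c); leg := cap_leg c |}.
Next Obligation.
destruct j; [destruct i |].
- exact (f_equal (@slice_mor _ _ _ _) (leg_nat c u)).
- destruct u.
- destruct i; simpl; [apply slice_comm | apply comp_idl].
Qed.

Lemma uncap_limit (c : Cone cap_functor) : IsLimit c -> IsLimit (uncap_cone c).
Proof.
intros H c'; destruct (H (cap_cone c')) as [h [Hh Hu]].
(* Compatibility of [h] with the leg at [None] says exactly that [h] is a morphism over [b]. *)
exists (Build_SliceHom (u := apex c') (v := apex (uncap_cone c)) (Hh None)).
split.
- intros j; apply slice_hom_eq, (Hh (Some j)).
- intros k Hk; apply slice_hom_eq, Hu; intros [j|]; simpl.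
  + now rewrite <- Hk.
  + apply (slice_comm k).
Qed.

End SliceLimits.

Lemma slice_complete (C : Category) (b : C) :
  FinitelyComplete C -> FinitelyComplete (Slice b).
Proof.
intros H J D HJ.
destruct (H _ (cap_functor D) (cap_finite HJ)) as [c Hc].
exists (uncap_cone c); now apply uncap_limit.
Qed.

(** * Isomorphisms, pullbacks and regular epimorphisms in a slice *)

Section SliceProperties.
Variables (C : Category) (b : C).

Program Definition slice_forget : Functor (Slice b) C :=
  {| fobj := fun u : Slice b => slice_dom u;
     fmap := fun u v (f : @Hom (Slice b) u v) => slice_mor f |}.

Lemma slice_iso (u v : Slice b) (f : Hom u v) :
  IsIso f <-> IsIso (slice_mor f).
Proof.
split; [exact (functor_iso slice_forget (f := f)) |].
intros [g [Hg Hg']].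
assert (H : slice_map u ∘ g = slice_map v)
  by now rewrite <- (slice_comm f), <- comp_assoc, Hg', comp_idr.
exists (@Build_SliceHom C b v u g H); now split; apply slice_hom_eq.
Qed.

(** A test pair in the base lifts to the slice: both of its members induce the same map to [b],
    namely the one passing through [z]. *)
Lemma slice_pullback_dom (x y z w : Slice b) (f : Hom x z) (g : Hom y z)
    (p : Hom w x) (q : Hom w y) :
  IsPullback f g p q ->
  IsPullback (slice_mor f) (slice_mor g) (slice_mor p) (slice_mor q).
Proof.
intros [E H]; split; [exact (f_equal (@slice_mor _ _ _ _) E) |].
intros v a c Hac.
pose (V := {| slice_map := slice_map x ∘ a |} : Slice b).
assert (Hc : slice_map y ∘ c = slice_map x ∘ a).
{ rewrite <- (slice_comm f), <- (slice_comm g), <- !comp_assoc.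
  now rewrite Hac. }
pose (A := @Build_SliceHom C b V x a eq_refl : Hom V x).
pose (K := @Build_SliceHom C b V y c Hc : Hom V y).
destruct (H V A K) as [h [[Hh1 Hh2] Hu]]; [now apply slice_hom_eq |].
exists (slice_mor h); split.
- exact (conj (f_equal (@slice_mor _ _ _ _) Hh1)
              (f_equal (@slice_mor _ _ _ _) Hh2)).
- intros k [Hk1 Hk2].
  assert (Hk : slice_map w ∘ k = slice_map V)
    by now rewrite <- (slice_comm p), <- comp_assoc, Hk1.
  rewrite (Hu (@Build_SliceHom C b V w k Hk)); [reflexivity |].
  now split; apply slice_hom_eq.
Qed.

Lemma slice_coequalizer (x y z : Slice b) (f g : Hom x y) (q : Hom y z) :
  IsCoequalizer (slice_mor f) (slice_mor g) (slice_mor q) ->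
  IsCoequalizer f g q.
Proof.
intros [E H]; split; [now apply slice_hom_eq |].
intros w h Hh.
destruct (H _ (slice_mor h)) as [k [Hk Hu]];
  [exact (f_equal (@slice_mor _ _ _ _) Hh) |].
(* Both sides factor [slice_map y] through [q], so uniqueness of such factorizations makes [k] a
   morphism over [b]. *)
assert (Hs : slice_map w ∘ k = slice_map z).
{ destruct (H _ (slice_map y)) as [l [_ Hl]].
  - now rewrite !slice_comm.
  - rewrite <- (Hl (slice_map w ∘ k)).
    + apply Hl, slice_comm.
    + now rewrite <- comp_assoc, Hk, slice_comm. }
exists (@Build_SliceHom C b z w k Hs); split; [now apply slice_hom_eq |].
intros k' Hk'; apply slice_hom_eq, Hu.
exact (f_equal (@slice_mor _ _ _ _) Hk').
Qed.

(** The coequalized pair lifts to the slice: [slice_map y] factors through [q], hence has the same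
    composite with [f] and with [g]. *)
Lemma slice_regular_epi (y z : Slice b) (q : Hom y z) :
  RegularEpi (slice_mor q) -> RegularEpi q.
Proof.
intros [x [f [g H]]].
pose (X := {| slice_map := slice_map y ∘ f |} : Slice b).
assert (Hg : slice_map y ∘ g = slice_map y ∘ f).
{ rewrite <- (slice_comm q), <- !comp_assoc; f_equal.
  symmetry; apply (proj1 H). }
exists X, (@Build_SliceHom C b X y f eq_refl), (@Build_SliceHom C b X y g Hg).
now apply slice_coequalizer.
Qed.

(** * The functor [x ↦ x × b] into the slice, right adjoint to the domain functor *)

Section ProductAdjoint.
Variables (pb : PullbackChoice C) (t : C) (Ht : IsTerminal t).
Variable bang : forall x : C, Hom x t.

(** The product of [x] and [b], as a pullback over the terminal object. *)
Definition prod_pb (x : C) : Pullback (bang x) (bang b) :=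
  pb (bang x) (bang b).

Lemma bang_comp (x y z : C) (f : Hom z x) (g : Hom z y) :
  bang x ∘ f = bang y ∘ g.
Proof. apply (terminal_hom_eq _ _ Ht). Qed.

Definition pairing (z x : C) (f : Hom z x) (g : Hom z b) :
    Hom z (pb_ob (prod_pb x)) :=
  pb_lift (prod_pb x) (bang_comp f g).

Lemma pairing_fst (z x : C) (f : Hom z x) (g : Hom z b) :
  pb_fst (prod_pb x) ∘ pairing f g = f.
Proof. apply pb_lift_fst. Qed.

Lemma pairing_snd (z x : C) (f : Hom z x) (g : Hom z b) :
  pb_snd (prod_pb x) ∘ pairing f g = g.
Proof. apply pb_lift_snd. Qed.

Program Definition slice_prod : Functor C (Slice b) :=
  {| fobj := fun x => {| slice_map := pb_snd (prod_pb x) |} : Slice b;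
     fmap := fun x y f =>
       {| slice_mor := pairing (f ∘ pb_fst (prod_pb x)) (pb_snd (prod_pb x)) |}
  |}.
Next Obligation. apply pairing_snd. Qed.
Next Obligation.
apply slice_hom_eq, (pb_hom_eq (P := prod_pb x)); simpl.
- now rewrite pairing_fst, comp_idl, comp_idr.
- now rewrite pairing_snd, comp_idr.
Qed.
Next Obligation.
apply slice_hom_eq, (pb_hom_eq (P := prod_pb z)); simpl; rewrite comp_assoc.
- now rewrite !pairing_fst, <- !comp_assoc, pairing_fst.
- now rewrite !pairing_snd.
Qed.

Program Definition slice_adjunction : Adjunction slice_forget slice_prod :=
  {| adj_to := fun (u : Slice b) x f =>
       {| slice_mor := pairing f (slice_map u) |};
     adj_from := fun u x g => pb_fst (prod_pb x) ∘ slice_mor g |}.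
Next Obligation. apply pairing_snd. Qed.
Next Obligation. apply pairing_fst. Qed.
Next Obligation.
apply slice_hom_eq, (pb_hom_eq (P := prod_pb c)); simpl.
- apply pairing_fst.
- rewrite pairing_snd; symmetry; apply (slice_comm g).
Qed.
Next Obligation.
apply slice_hom_eq, (pb_hom_eq (P := prod_pb c')); simpl; rewrite !comp_assoc.
- now rewrite !pairing_fst, <- (comp_assoc k (pb_fst _)), pairing_fst.
- rewrite !pairing_snd; symmetry; apply (slice_comm h).
Qed.

(** Since the functor acts on [f] by base change along a projection, stability of regular
    epimorphisms shows that it preserves them. *)
Lemma slice_prod_pullback (x y : C) (f : Hom x y) :
  IsPullback f (pb_fst (prod_pb y)) (pb_fst (prod_pb x))
    (slice_mor (fmap slice_prod f)).
Proof.
split; [now simpl; rewrite pairing_fst |].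
intros v a c E; exists (pairing a (pb_snd (prod_pb y) ∘ c)); split.
- split; [apply pairing_fst |].
  apply (pb_hom_eq (P := prod_pb y)); simpl; rewrite comp_assoc.
  + now rewrite pairing_fst, <- comp_assoc, pairing_fst.
  + now rewrite !pairing_snd.
- intros k [Hk1 Hk2]; apply (pb_hom_eq (P := prod_pb x)).
  + now rewrite pairing_fst.
  + rewrite pairing_snd, <- Hk2, comp_assoc; simpl; now rewrite pairing_snd.
Qed.

(** The product square with its legs exchanged, in the orientation that [UniversalExtremalEpi]
    expects; the projections to [x] thereby become extremal epimorphisms. *)
Lemma prod_fst_pullback (x : C) :
  IsPullback (bang b) (bang x) (pb_snd (prod_pb x)) (pb_fst (prod_pb x)).
Proof.
destruct (pb_is (prod_pb x)) as [E H]; split; [now symmetry |].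
intros v a c Hac; destruct (H v c a (eq_sym Hac)) as [h [[H1 H2] Hu]].
exists h; split; [now split |].
intros k [Hk1 Hk2]; now apply Hu.
Qed.

(** Epimorphic projections make the functor faithful, so [f] is monic once its image is invertible.
    The projection onto [y], an extremal epimorphism, then factors through the mono [f], which is
    therefore an isomorphism. *)
Lemma slice_prod_conservative :
  UniversalExtremalEpi (bang b) -> Conservative slice_prod.
Proof.
intros [_ Hb] x y f [g [Hgf Hfg]].
assert (He : forall z, ExtremalEpi (pb_fst (prod_pb z)))
  by (intros z; exact (Hb _ _ _ _ _ (prod_fst_pullback z))).
assert (Hfst : forall z w (h : Hom z w),
  h ∘ pb_fst (prod_pb z)
  = pb_fst (prod_pb w) ∘ slice_mor (fmap slice_prod h))
  by (intros; exact (proj1 (slice_prod_pullback h))).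
refine (proj2 (He y) x (pb_fst (prod_pb x) ∘ slice_mor g) f _ _).
- intros z h k E; apply (proj1 (He z)); rewrite !Hfst; do 2 f_equal.
  rewrite <- (comp_idl (fmap slice_prod h)), <- (comp_idl (fmap slice_prod k)).
  now rewrite <- Hgf, <- !comp_assoc, <- !fmap_comp, E.
- rewrite comp_assoc, Hfst, <- comp_assoc.
  apply (f_equal (@slice_mor _ _ _ _)) in Hfg; simpl in *.
  now rewrite Hfg, comp_idr.
Qed.

Lemma slice_prod_regular : Regular C -> RegularFunctor slice_prod.
Proof.
intros [_ [_ Hst]]; split.
- intros J D c _; exact (right_adjoint_preserves_limit slice_adjunction (c := c)).
- intros x y f Hf; apply slice_regular_epi.
  exact (Hst _ _ _ _ _ _ _ _ (slice_prod_pullback f) Hf).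
Qed.

End ProductAdjoint.

(** * Regularity, protomodularity and zero object of a slice *)

Lemma slice_regular : Regular C -> Regular (Slice b).
Proof.
intros [Hlim [Hker Hst]]; split; [now apply slice_complete | split].
- intros x y r f p q H; apply slice_pullback_dom in H.
  destruct (Hker _ _ _ _ _ _ H) as [z [e He]].
  (* The structure map of [x] coequalizes the kernel pair, so it descends to [z] and places [e] in
     the slice. *)
  destruct (proj2 He _ (slice_map x)) as [l [Hl _]];
    [now rewrite !slice_comm |].
  pose (Z := {| slice_map := l |} : Slice b).
  exists Z, (@Build_SliceHom C b x Z e Hl); now apply slice_coequalizer.
- intros x y z w f g p q H Hf; apply slice_regular_epi.
  apply slice_pullback_dom in H; refine (Hst _ _ _ _ _ _ _ _ H _).
  (* Regular epimorphisms of the slice stay regular in the base, because the domain functor is left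
     adjoint to the product with [b]. *)
  destruct (complete_terminal Hlim) as [t Ht].
  destruct (complete_pullback_choice Hlim) as [pb].
  pose (bang := fun x => proj1_sig (constructive_indefinite_description _
    (Ht x))).
  exact (left_adjoint_preserves_regular_epi (slice_adjunction pb Ht bang) Hf).
Qed.

(** Forgetting structure maps turns points and pullback squares of the slice into those of the base,
    and isomorphisms are reflected. *)
Lemma slice_protomodular : Protomodular C -> Protomodular (Slice b).
Proof.
rewrite !protomodular_iff; intros [Hlim H].
split; [now apply slice_complete |].
intros a a' x y c c' f s f' s' k v p q p' q' m Hs Hs' Hk Hks Hp Hp' Hm Hmq Hi.
pose (E := fun u v => f_equal (@slice_mor C b u v)).
apply slice_iso; apply slice_iso in Hi.
exact (H _ _ _ _ _ _ _ _ _ _ _ _ _ _ _ _ _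
  (E _ _ _ _ Hs) (E _ _ _ _ Hs') (E _ _ _ _ Hk) (E _ _ _ _ Hks)
  (slice_pullback_dom Hp) (slice_pullback_dom Hp')
  (E _ _ _ _ Hm) (E _ _ _ _ Hmq) Hi).
Qed.

Lemma slice_initial_pointed : IsInitial b -> Pointed (Slice b).
Proof.
intros Hb; exists ({| slice_map := idm b |} : Slice b); split.
- intros u; destruct (Hb (slice_dom u)) as [f _].
  assert (Hf : slice_map u ∘ f = idm b) by apply (initial_hom_eq _ _ Hb).
  exists (@Build_SliceHom C b {| slice_map := idm b |} u f Hf).
  split; [exact I |].
  intros g _; apply slice_hom_eq, (initial_hom_eq _ _ Hb).
- intros u.
  exists (@Build_SliceHom C b u {| slice_map := idm b |} (slice_map u)
    (comp_idl _)).
  split; [exact I |].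
  intros g _; apply slice_hom_eq; simpl; rewrite <- (slice_comm g).
  apply comp_idl.
Qed.

End SliceProperties.

(** * The cycle of implications *)

Lemma prohomological_slice (A : Category) :
  Prohomological A ->
  Propointed A /\ forall z : A, IsInitial z -> Homological (Slice z).
Proof.
intros [Hp [Hr Hm]]; split; [exact Hp |].
intros z Hz; split; [now apply slice_initial_pointed |].
split; [now apply slice_regular | now apply slice_protomodular].
Qed.

Lemma propointed_right_adjoint (A : Category) :
  Regular A -> Propointed A ->
  (forall z : A, IsInitial z -> Homological (Slice z)) ->
  exists (X : Category) (U : Functor A X),
    Homological X /\ RegularFunctor U /\ Conservative U /\ RightAdjoint U.
Proof.
intros hA [Hlim [z [t [f [Hz [Ht Hf]]]]]] H.
destruct (complete_pullback_choice Hlim) as [pb].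
pose (bang := fun x => proj1_sig (constructive_indefinite_description _
  (Ht x))).
exists (Slice z), (slice_prod z pb Ht bang).
split; [| split; [| split]].
- now apply H.
- now apply slice_prod_regular.
- apply slice_prod_conservative.
  now rewrite (terminal_hom_eq (bang z) f Ht).
- exists (slice_forget z); constructor; apply slice_adjunction.
Qed.

(** If [f] factors through a mono [m], then [fmap U m] is monic, and it is split because [fmap U f]
    is; hence it is invertible, and so is [m] by conservativity. *)
Lemma conservative_split_epi_extremal (A X : Category) (U : Functor A X) :
  FinitelyComplete A -> PreservesFiniteLimits U -> Conservative U ->
  forall (x y : A) (f : Hom x y) (s : Hom (U y) (U x)),
    fmap U f ∘ s = idm (U y) -> ExtremalEpi f.
Proof.
intros Hlim HU Hc x y f s Hs.
destruct (complete_terminal Hlim) as [t Ht].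
destruct (complete_pullback_choice Hlim) as [pb].
apply (extremal_epi_intro pb Ht).
intros z g m Hm E; apply Hc.
apply (split_epi_mono_iso (s := fmap U g ∘ s)).
- now apply preserves_mono.
- now rewrite comp_assoc, <- fmap_comp, E.
Qed.

Lemma conservative_prohomological (A X : Category) (U : Functor A X) :
  Regular A -> HasInitial A -> Homological X -> RegularFunctor U ->
  Conservative U -> Prohomological A.
Proof.
intros hA [z Hz] [[o [Ho Ho']] [_ HX]] [HU _] Hc.
pose proof (proj1 hA) as Hlim.
split; [split; [exact Hlim |] | split; [exact hA |]].
- destruct (complete_terminal Hlim) as [t Ht].
  destruct (Ht z) as [f _].
  exists z, t, f; split; [exact Hz | split; [exact Ht |]].
  (* The section goes from [U t] to [U z] through the zero object [o]; the equation is automatic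
     because [U t] is terminal. *)
  assert (Hs : exists s, fmap U f ∘ s = idm (U t)).
  { pose proof (preserves_terminal HU Ht) as HUt.
    destruct (Ho' (U t)) as [a _], (Ho (U z)) as [b _].
    exists (b ∘ a); apply (terminal_hom_eq _ _ HUt). }
  destruct Hs as [s Hs]; split.
  + exact (conservative_split_epi_extremal Hlim HU Hc Hs).
  + intros y w g p q H.
    (* Splitness passes to pullbacks in [X], so [fmap U q] has a section as well and [q] is extremal
       by the same criterion. *)
    destruct (pullback_split_epi (preserves_pullback HU H) Hs) as [r Hr].
    exact (conservative_split_epi_extremal Hlim HU Hc Hr).
- apply protomodular_iff; split; [exact Hlim |].
  apply (conservative_reflects_point_isos HU Hc).
  now apply protomodular_iff.
Qed.

Theorem proposition5p2 (A : Category) (hA : Regular A) :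
  (Prohomological A <->
   (Propointed A /\
    forall z : A, IsInitial z -> Homological (Slice z))) /\
  ((Propointed A /\
    forall z : A, IsInitial z -> Homological (Slice z)) <->
   (exists (X : Category) (U : Functor A X),
      Homological X /\ RegularFunctor U /\ Conservative U /\
      RightAdjoint U)) /\
  ((exists (X : Category) (U : Functor A X),
      Homological X /\ RegularFunctor U /\ Conservative U /\
      RightAdjoint U) <->
   (HasInitial A /\
    exists (X : Category) (U : Functor A X),
      Homological X /\ RegularFunctor U /\ Conservative U)).
Proof.
pose proof (@prohomological_slice A) as H12.
pose proof (@propointed_right_adjoint A hA) as H23.
assert (H34 : (exists (X : Category) (U : Functor A X),
      Homological X /\ RegularFunctor U /\ Conservative U /\
      RightAdjoint U) ->
   (HasInitial A /\
    exists (X : Category) (U : Functor A X),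
      Homological X /\ RegularFunctor U /\ Conservative U)).
{ intros [X [U [HX [HU [Hc [F [adj]]]]]]]; split; [| now exists X, U].
  destruct HX as [[o [Ho _]] _].
  exists (F o); now apply (left_adjoint_preserves_initial adj). }
assert (H41 : (HasInitial A /\
    exists (X : Category) (U : Functor A X),
      Homological X /\ RegularFunctor U /\ Conservative U) ->
   Prohomological A).
{ intros [Hi [X [U [HX [HU Hc]]]]].
  exact (conservative_prohomological hA Hi HX HU Hc). }
tauto.
Qed.
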